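(* Let $N,K$ be positive integers, $V>0$, $D(\alpha)>0$, and for each $j\in[K]$ let $\mu_j\ge 0$, $b_j>0$ and $m_j$ a non-negative integer. Consider the following two problems on empty machines, with the allocation variables relaxed to real values. (A) (Relaxed UCaC minimization) $$\min_{x}\ \sum_{i=1}^{N} D(\alpha)\sqrt{\sum_{j=1}^{K} x_{i,j}b_j}$$ subject to $\sum_{j=1}^{K}x_{i,j}\mu_j + D(\alpha)\sqrt{\sum_{j=1}^{K}x_{i,j}b_j}\le V$ for all $i\in[N]$, $\sum_{i=1}^{N}x_{i,j}=m_j$ for all $j\in[K]$, and $x_{i,j}\in\mathbb{R}$, $x_{i,j}\ge 0$. (B) (Relaxed minimization of the number of used machines) $$\min_{x,y}\ \sum_{i=1}^{N} y_i$$ subject to $\sum_{j=1}^{K}x_{i,j}\mu_j + D(\alpha)\sqrt{\sum_{j=1}^{K}x_{i,j}b_j}\le V y_i$ for all $i\in[N]$, $\sum_{i=1}^{N}x_{i,j}=m_j$ for all $j\in[K]$, $x_{i,j}\in\mathbb{R}$, $x_{i,j}\ge 0$, and $y_i\in\{0,1\}$. Assume these problems are feasible. Then every optimal solution $x$ of (A) uses the least possible number of machines, i.e. the number of machines $i\in[N]$ used by $x$ equals the optimal value of (B).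
   Context: $[n]$ denotes $\{1,\dots,n\}$. There are $N$ machines, each of capacity $V$, all initially empty, and $K$ services; service $j$ requests $m_j$ containers, each with mean resource usage $\mu_j$ and uncertainty (e.g. variance) $b_j$. The variable $x_{i,j}$ is the amount of containers of service $j$ placed on machine $i$. $D(\alpha)$ is a constant depending on the confidence level $\alpha$ (for Gaussian usage, the $\alpha$-quantile of the standard normal distribution). The UCaC (Used Capacity at Confidence) of machine $i$ is $\sum_j x_{i,j}\mu_j + D(\alpha)\sqrt{\sum_j x_{i,j}b_j}$, and the UCaC of the cluster is the sum over all machines. Since $\sum_i\sum_j x_{i,j}\mu_j=\sum_j m_j\mu_j$ is constant on feasible points, minimizing the cluster UCaC is equivalent to minimizing the objective of (A). A machine $i$ is used by $x$ if $x_{i,j}>0$ for some $j\in[K]$. *)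

(* Defs.v *)
From mathcomp Require Import all_boot all_order all_algebra.
From mathcomp Require Import reals.

Set Implicit Arguments.
Unset Strict Implicit.
Unset Printing Implicit Defensive.

Import Order.TTheory GRing.Theory Num.Theory.
Local Open Scope ring_scope.

Definition is_minimizer (R : realType) (T : Type) (feasible : T -> Prop)
    (f : T -> R) (x : T) : Prop :=
  feasible x /\ forall x', feasible x' -> f x <= f x'.

Definition is_min_value (R : realType) (T : Type) (feasible : T -> Prop)
    (f : T -> R) (v : R) : Prop :=
  exists2 x, is_minimizer feasible f x & f x = v.

(* In an allocation x : 'M[R]_(N, K), rows are machines and columns are
   services; D stands for the constant D(alpha). *)

Definition confidence_margin (R : realType) (N K : nat) (b : 'I_K -> R) (D : R)
    (x : 'M[R]_(N, K)) (i : 'I_N) : R :=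
  D * Num.sqrt (\sum_(j < K) x i j * b j).

(* Used Capacity at Confidence of machine i. *)
Definition ucac (R : realType) (N K : nat) (mu b : 'I_K -> R) (D : R)
    (x : 'M[R]_(N, K)) (i : 'I_N) : R :=
  \sum_(j < K) x i j * mu j + confidence_margin b D x i.

Definition allocation (R : realType) (N K : nat) (m : 'I_K -> nat)
    (x : 'M[R]_(N, K)) : Prop :=
  (forall j, \sum_(i < N) x i j = (m j)%:R) /\ (forall i j, 0 <= x i j).

Definition feasibleA (R : realType) (N K : nat) (mu b : 'I_K -> R)
    (m : 'I_K -> nat) (V D : R) (x : 'M[R]_(N, K)) : Prop :=
  (forall i, ucac mu b D x i <= V) /\ allocation m x.

Definition objectiveA (R : realType) (N K : nat) (b : 'I_K -> R) (D : R)
    (x : 'M[R]_(N, K)) : R :=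
  \sum_(i < N) confidence_margin b D x i.

Definition feasibleB (R : realType) (N K : nat) (mu b : 'I_K -> R)
    (m : 'I_K -> nat) (V D : R) (xy : 'M[R]_(N, K) * ('I_N -> R)) : Prop :=
  [/\ forall i, ucac mu b D xy.1 i <= V * xy.2 i,
      allocation m xy.1 &
      forall i, xy.2 i = 0 \/ xy.2 i = 1].

Definition objectiveB (R : realType) (N K : nat)
    (xy : 'M[R]_(N, K) * ('I_N -> R)) : R :=
  \sum_(i < N) xy.2 i.

Definition used_machines (R : realType) (N K : nat) (x : 'M[R]_(N, K)) :
    {set 'I_N} :=
  [set i | [exists j, 0 < x i j]].

(* Main.v *)
Require Import Defs.
From mathcomp Require Import all_boot all_order all_algebra.
From mathcomp Require Import reals.
From mathcomp Require Import lra.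

Import Order.TTheory GRing.Theory Num.Theory.
Local Open Scope ring_scope.

(** On allocations, the cluster UCaC is objective (A) plus the constant
    [\sum_j m j * mu j]; hence a minimizer [x] of (A) also minimizes the
    cluster UCaC.

    The square root is strictly concave, so moving a little of a service from
    a machine of smaller variance to one of larger variance strictly lowers
    objective (A) ([sqrt_spread_lt], [transfer_improves]).  Such a move is
    allowed whenever the receiving machine has spare capacity, so two used
    machines of a minimizer cannot both have spare capacity
    ([minimizer_one_slack]).  If the minimizer uses [k > 0] machines, then
    at least [k - 1] of them are full and the remaining one carries a positive
    UCaC, so its cluster UCaC exceeds [(k - 1) V] ([used_machines_lt_ucac]).

    A feasible point of (B) with [n] machines switched on is feasible for (A)
    and has cluster UCaC at most [n V].  By minimality of [x],
    [(k - 1) V < n V], that is [k <= n].  Switching on exactly the machines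
    used by [x] attains [k]. *)

(** * Strict concavity of the square root *)

Section SquareRoot.

Variable R : realType.
Implicit Types s t c : R.

(** The sum of the two radicands is unchanged while their product drops by
    [c * (t - s) + c ^+ 2 > 0]; the square of the sum of the roots
    involves just these two quantities. *)
Lemma sqrt_spread_lt s t c : 0 < c -> c <= s -> s <= t ->
  Num.sqrt (s - c) + Num.sqrt (t + c) < Num.sqrt s + Num.sqrt t.
Proof.
move=> c0 cs st.
have s0 : 0 <= s by lra.
have t0 : 0 <= t by lra.
have sc0 : 0 <= s - c by lra.
have tc0 : 0 <= t + c by lra.
have prod_lt : Num.sqrt (s - c) * Num.sqrt (t + c) < Num.sqrt s * Num.sqrt t.
  by rewrite -!sqrtrM // ltr_sqrt; nra.
rewrite -(ltr_pXn2r (n := 2)) ?nnegrE ?addr_ge0 ?sqrtr_ge0 //.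
by rewrite !sqrrD !sqr_sqrtr //; lra.
Qed.

(** A Lipschitz bound on [sqrt] to the right of [t > 0]; it makes a small
    enough increase of variance fit into any positive spare capacity. *)
Lemma sqrt_addr_le t c : 0 < t -> 0 <= c ->
  Num.sqrt (t + c) <= Num.sqrt t + c / Num.sqrt t.
Proof.
move=> t0 c0; have r0 : 0 < Num.sqrt t by rewrite sqrtr_gt0.
have q0 : 0 <= c / Num.sqrt t by rewrite divr_ge0 // ltW.
have cE : Num.sqrt t * (c / Num.sqrt t) = c by rewrite mulrC divfK // gt_eqF.
rewrite -(ler_pXn2r (n := 2)) ?nnegrE ?sqrtr_ge0 ?addr_ge0 ?(ltW r0) //.
rewrite sqrrD cE !sqr_sqrtr ?addr_ge0 ?(ltW t0) //.
by have := sqr_ge0 (c / Num.sqrt t); lra.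
Qed.

End SquareRoot.

(** * Used capacity of allocations *)

Section Allocations.

Set Implicit Arguments.
Unset Strict Implicit.

Variables (R : realType) (N K : nat) (V D : R).
Variables (mu b : 'I_K -> R) (m : 'I_K -> nat).
Hypotheses (V_gt0 : 0 < V) (D_gt0 : 0 < D).
Hypotheses (mu_ge0 : forall j, 0 <= mu j) (b_gt0 : forall j, 0 < b j).
Implicit Types (x : 'M[R]_(N, K)) (w : 'I_K -> R) (i : 'I_N) (j : 'I_K).

Lemma sum_ucac x : allocation m x ->
  \sum_i ucac mu b D x i = \sum_j (m j)%:R * mu j + objectiveA b D x.
Proof.
move=> [xm _]; rewrite big_split /=; congr (_ + _).
by rewrite exchange_big /=; apply: eq_bigr => j _; rewrite -mulr_suml xm.
Qed.

Lemma ucac_ge0 x i : (forall i j, 0 <= x i j) -> 0 <= ucac mu b D x i.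
Proof.
move=> x0; rewrite addr_ge0 ?mulr_ge0 ?sqrtr_ge0 ?(ltW D_gt0) //.
by apply: sumr_ge0 => j _; rewrite mulr_ge0.
Qed.

Lemma used_variance_gt0 x i : (forall i j, 0 <= x i j) ->
  i \in used_machines x -> 0 < \sum_j x i j * b j.
Proof.
move=> x0; rewrite inE => /existsP[j xij]; rewrite (bigD1 j) //=.
rewrite ltr_pwDl ?mulr_gt0 //.
by apply: sumr_ge0 => k _; rewrite mulr_ge0 // ltW.
Qed.

Lemma used_ucac_gt0 x i : (forall i j, 0 <= x i j) ->
  i \in used_machines x -> 0 < ucac mu b D x i.
Proof.
move=> x0 iU; rewrite ltr_wpDl //; last first.
  by rewrite mulr_gt0 // sqrtr_gt0 used_variance_gt0.
by apply: sumr_ge0 => j _; rewrite mulr_ge0.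
Qed.

Lemma unused_ucac x i : (forall i j, 0 <= x i j) ->
  i \notin used_machines x -> ucac mu b D x i = 0.
Proof.
move=> x0; rewrite inE negb_exists => /forallP xi0.
have xi j : x i j = 0 by apply/eqP; rewrite eq_le x0 andbT leNgt xi0.
rewrite /ucac /confidence_margin.
by rewrite !big1 ?sqrtr0 ?mulr0 ?addr0 // => j _; rewrite xi mul0r.
Qed.

(** * Moving containers between two machines *)

Definition transfer x j i1 i2 (t : R) : 'M[R]_(N, K) :=
  x + t *: (delta_mx i2 j - delta_mx i1 j).

Lemma transferE x j i1 i2 t i k : transfer x j i1 i2 t i k =
  x i k + t * (((i == i2) && (k == j))%:R - ((i == i1) && (k == j))%:R).
Proof. by rewrite !mxE. Qed.

Lemma transfer_load x j i1 i2 t w i :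
  \sum_k transfer x j i1 i2 t i k * w k =
  \sum_k x i k * w k + t * w j * ((i == i2)%:R - (i == i1)%:R).
Proof.
have -> : t * w j * ((i == i2)%:R - (i == i1)%:R) =
    \sum_(k | k == j) t * w k * ((i == i2)%:R - (i == i1)%:R).
  by rewrite big_pred1_eq.
rewrite [X in _ + X]big_mkcond -big_split /=; apply: eq_bigr => k _.
rewrite transferE mulrDl; congr (_ + _).
by case: (k == j); rewrite ?andbT ?andbF ?subrr ?mulr0 ?mul0r // mulrAC.
Qed.

Lemma transfer_allocation x j i1 i2 t : i1 != i2 -> 0 <= t -> t <= x i1 j ->
  allocation m x -> allocation m (transfer x j i1 i2 t).
Proof.
move=> ne t0 tx [xm x0]; split=> [k|i k].
  rewrite -xm (eq_bigr _ (fun i _ => transferE x j i1 i2 t i k)) big_split /=.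
  rewrite -mulr_sumr sumrB.
  have one i0 : \sum_i ((i == i0) && (k == j))%:R = (k == j)%:R :> R.
    by rewrite (bigD1 i0) //= eqxx big1 ?addr0 // => i /negPf ->.
  by rewrite !one subrr mulr0 addr0.
rewrite transferE; have := x0 i k.
have [->|_] := eqVneq i i1; last by move=> ?; rewrite subr0 addr_ge0 ?mulr_ge0.
rewrite (negPf ne) /= sub0r.
by have [->|_] := eqVneq k j; rewrite ?mulrN1 ?oppr0 ?mulr0 ?addr0 // subr_ge0.
Qed.

(** The amount [t] is limited by what machine [i1] holds and by the spare
    capacity of [i2]; the donor needs no spare capacity, as its UCaC drops. *)
Lemma transfer_improves x j i1 i2 : i1 != i2 -> feasibleA mu b m V D x ->
    0 < x i1 j -> ucac mu b D x i2 < V ->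
    \sum_k x i1 k * b k <= \sum_k x i2 k * b k ->
  exists2 x' : 'M[R]_(N, K),
    feasibleA mu b m V D x' & objectiveA b D x' < objectiveA b D x.
Proof.
move=> ne [xV xa] xj slack le12; have [_ x0] := xa.
set s := \sum_k x i1 k * b k in le12; set s' := \sum_k x i2 k * b k in le12.
have s_gt0 : 0 < s.
  by apply: used_variance_gt0 => //; rewrite inE; apply/existsP; exists j.
have s'_gt0 : 0 < s' by exact: lt_le_trans le12.
(* An upper bound on the UCaC growth of [i2] per unit of service [j]. *)
pose rate := mu j + D * (b j / Num.sqrt s').
have rate_gt0 : 0 < rate.
  by rewrite ltr_wpDl // mulr_gt0 // divr_gt0 // sqrtr_gt0.
pose t := Num.min (x i1 j) ((V - ucac mu b D x i2) / rate).
have t_gt0 : 0 < t by rewrite lt_min xj divr_gt0 // subr_gt0.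
have t_x : t <= x i1 j by rewrite ge_min lexx.
have t_rate : t * rate <= V - ucac mu b D x i2.
  by rewrite -ler_pdivlMr // ge_min lexx orbT.
have c_gt0 : 0 < t * b j by exact: mulr_gt0.
have c_le : t * b j <= s.
  rewrite /s (bigD1 j) //= ler_wpDr ?ler_pM2r //.
  by apply: sumr_ge0 => k _; rewrite mulr_ge0 // ltW.
pose x' := transfer x j i1 i2 t.
have var1 : confidence_margin b D x' i1 = D * Num.sqrt (s - t * b j).
  by rewrite /confidence_margin transfer_load eqxx (negPf ne) sub0r mulrN1.
have var2 : confidence_margin b D x' i2 = D * Num.sqrt (s' + t * b j).
  rewrite /confidence_margin transfer_load eqxx eq_sym (negPf ne).
  by rewrite subr0 mulr1.
have varN i : i != i1 -> i != i2 ->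
    confidence_margin b D x' i = confidence_margin b D x i.
  move=> /negPf n1 /negPf n2.
  by rewrite /confidence_margin transfer_load n1 n2 subrr mulr0 addr0.
exists x'; first split.
- move=> i; rewrite /ucac transfer_load.
  have [->|n1] := eqVneq i i1.
    rewrite var1 (negPf ne) sub0r mulrN1; apply: le_trans (xV i1).
    rewrite lerD ?ler_pM2l ?ler_wsqrtr ?gerBl ?mulr_ge0 ?(ltW t_gt0) //.
    exact: ltW.
  have [->|n2] := eqVneq i i2; last first.
    by rewrite varN // subrr mulr0 addr0; exact: xV.
  rewrite var2 subr0 mulr1.
  have := @sqrt_addr_le R s' _ s'_gt0 (ltW c_gt0).
  rewrite -(ler_pM2l D_gt0) => root_le.
  move: t_rate; rewrite /ucac /confidence_margin -/s' /rate.
  by move: root_le; rewrite -mulrA; lra.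
- exact: transfer_allocation (ltW t_gt0) t_x xa.
rewrite /objectiveA (bigD1 i1) // (bigD1 i2) 1?eq_sym //=.
rewrite [ltRHS](bigD1 i1) // [X in _ < _ + X](bigD1 i2) 1?eq_sym //= !addrA.
rewrite (eq_bigr (confidence_margin b D x)); last first.
  by move=> i /andP[n1 n2]; exact: varN.
rewrite ltrD2r var1 var2 /confidence_margin -!mulrDr ltr_pM2l //.
exact: sqrt_spread_lt.
Qed.

(** * Minimizers of the UCaC *)

(** Of two used machines with spare capacity, the one of smaller variance
    can give some of its containers to the other, which would improve a
    minimizer. *)
Lemma minimizer_one_slack x i1 i2 :
    is_minimizer (feasibleA mu b m V D) (objectiveA b D) x ->
    i1 \in used_machines x -> i2 \in used_machines x ->
    ucac mu b D x i1 < V -> ucac mu b D x i2 < V ->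
  i1 = i2.
Proof.
move=> [xF xmin] U1 U2 s1 s2; apply/eqP/negPn/negP => ne.
suff [x' /xmin] : exists2 x' : 'M[R]_(N, K), feasibleA mu b m V D x' &
    objectiveA b D x' < objectiveA b D x by case: leP.
move: U1 U2; rewrite !inE => /existsP[j1 x1] /existsP[j2 x2].
have [le|/ltW le] := lerP (\sum_k x i1 k * b k) (\sum_k x i2 k * b k).
  exact: (transfer_improves ne xF x1 s2 le).
by rewrite eq_sym in ne; exact: (transfer_improves ne xF x2 s1 le).
Qed.

(** Singling out the machine that may be partly empty leaves
    [#|used_machines x| - 1] full ones; strictness comes from the positive
    UCaC of the machine singled out. *)
Lemma used_machines_lt_ucac x :
    is_minimizer (feasibleA mu b m V D) (objectiveA b D) x ->
    (0 < #|used_machines x|)%N ->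
  #|used_machines x|.-1%:R * V < \sum_i ucac mu b D x i.
Proof.
move=> xmin; have [[xV [_ x0]] _] := xmin.
move=> /card_gt0P[i iU]; set U := used_machines x in iU *.
have [i0 i0U full] : exists2 i0, i0 \in U &
    forall k, k \in U -> k != i0 -> V <= ucac mu b D x k.
  have [/existsP[i0 /andP[i0U slack]]|] :=
      boolP [exists k, (k \in U) && (ucac mu b D x k < V)].
    exists i0 => // k kU; apply: contraR; rewrite -ltNge => slackk.
    by apply/eqP; exact: minimizer_one_slack xmin kU i0U slackk slack.
  rewrite negb_exists => /forallP noslack; exists i => // k kU _.
  by move: (noslack k); rewrite kU /= -leNgt.
rewrite (bigID [in U]) /= (bigD1 i0) //=.
have rest_ge0 : 0 <= \sum_(k | k \notin U) ucac mu b D x k.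
  by apply: sumr_ge0 => k _; exact: ucac_ge0.
have full_ge : #|U|.-1%:R * V <= \sum_(k in U | k != i0) ucac mu b D x k.
  have -> : #|U|.-1 = #|[pred k in U | k != i0]|.
    rewrite (cardsD1 i0) i0U /=; apply: eq_card => k.
    by rewrite !inE andbC.
  rewrite mulr_natl -sumr_const; apply: ler_sum => k /andP[kU kn].
  exact: full.
by have := used_ucac_gt0 x0 i0U; lra.
Qed.

(** * Minimizing the number of machines *)

Lemma feasibleB_objective_nat (xy : 'M[R]_(N, K) * ('I_N -> R)) :
  feasibleB mu b m V D xy -> exists n : nat, objectiveB xy = n%:R.
Proof.
move=> [_ _ y01]; exists (\sum_i (xy.2 i == 1%R :> R))%N.
rewrite /objectiveB natr_sum; apply: eq_bigr => i _.
by case: (y01 i) => ->; rewrite ?eqxx // eq_sym oner_eq0.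
Qed.

Lemma feasibleB_feasibleA (xy : 'M[R]_(N, K) * ('I_N -> R)) :
  feasibleB mu b m V D xy -> feasibleA mu b m V D xy.1.
Proof.
move=> [xV xa y01]; split=> // i; apply: le_trans (xV i) _.
by case: (y01 i) => ->; rewrite ?mulr0 ?mulr1 // ltW.
Qed.

Lemma used_feasibleB x : feasibleA mu b m V D x ->
  feasibleB mu b m V D (x, fun i => (i \in used_machines x)%:R).
Proof.
move=> [xV xa]; have [_ x0] := xa; split=> //= i; last first.
  by case: (i \in _); [right | left].
have [iU|iU] := boolP (i \in _); first by rewrite mulr1; exact: xV.
by rewrite mulr0 (@unused_ucac x i).
Qed.

Lemma objectiveB_used x :
  objectiveB (x, fun i => (i \in used_machines x)%:R) =
  #|used_machines x|%:R :> R.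
Proof.
by rewrite /objectiveB /= -natr_sum -sum1_card [in RHS]big_mkcond.
Qed.

End Allocations.

Theorem theorem4 (R : realType) (N K : nat) (V D : R)
    (mu b : 'I_K -> R) (m : 'I_K -> nat)
    (N_gt0 : (0 < N)%N) (K_gt0 : (0 < K)%N) (V_gt0 : 0 < V) (D_gt0 : 0 < D)
    (mu_ge0 : forall j, 0 <= mu j) (b_gt0 : forall j, 0 < b j)
    (feasA : exists x : 'M[R]_(N, K), feasibleA mu b m V D x)
    (feasB : exists xy : 'M[R]_(N, K) * ('I_N -> R), feasibleB mu b m V D xy)
    (x : 'M[R]_(N, K)) :
  is_minimizer (feasibleA mu b m V D) (objectiveA b D) x ->
  is_min_value (feasibleB mu b m V D) (@objectiveB R N K)
    #|used_machines x|%:R.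
Proof.
move=> xmin; have [xF xle] := xmin.
exists (x, fun i => (i \in used_machines x)%:R); last exact: objectiveB_used.
split=> [|xy xyF]; first exact: used_feasibleB.
rewrite objectiveB_used.
have [n nE] := feasibleB_objective_nat xyF.
rewrite nE ler_nat.
case: (posnP #|used_machines x|) => [-> //|k_gt0].
rewrite -(prednK k_gt0) -(ltr_nat R) -(ltr_pM2r V_gt0).
apply: lt_le_trans (used_machines_lt_ucac D_gt0 mu_ge0 b_gt0 xmin k_gt0) _.
have xyA := feasibleB_feasibleA V_gt0 xyF.
rewrite (sum_ucac D mu b xF.2).
apply: le_trans (_ : \sum_i ucac mu b D xy.1 i <= _).
  by rewrite (sum_ucac D mu b xyA.2) lerD2l; exact: xle.
rewrite -nE mulrC mulr_sumr; apply: ler_sum => i _.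
by case: xyF => + _ _; apply.
Qed.
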